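(* Let $\mathbf{A}$ be an algebra and let $\alpha,\beta,\gamma,\delta\in\operatorname{Con}(\mathbf{A})$ be such that $\{0_{\mathbf{A}},\gamma,\alpha,\beta,\delta\}$ is a labelled pentagon in $\operatorname{Con}(\mathbf{A})$. Suppose that the interval $[\gamma,\alpha]$ of $\operatorname{Con}(\mathbf{A})$ equals $\{\gamma,\alpha\}$. Let $\mathbf{L}$ be the sublattice of $\operatorname{Con}(\mathbf{A}(\beta))$ generated by $\{\alpha_0,\alpha_1,\gamma_0,\gamma_1,\beta_0\}$. Then: (1) $\mathbf{L}$ is isomorphic to $\mathbf{K}$ if and only if $(\beta\circ\gamma\circ\beta)\cap\alpha\not\subseteq\gamma$; (2) otherwise (that is, if $(\beta\circ\gamma\circ\beta)\cap\alpha\subseteq\gamma$), $\mathbf{L}$ is isomorphic to $\mathbf{M}_1$.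
   Context: Algebras are in the sense of universal algebra; $\operatorname{Con}(\mathbf{A})$ is the lattice of congruences of $\mathbf{A}$, $0_{\mathbf{A}}$ is the identity congruence (equality), and $\circ$ is relational composition. A labelled pentagon $\{0_{\mathbf{A}},\gamma,\alpha,\beta,\delta\}$ in $\operatorname{Con}(\mathbf{A})$ is a five-element sublattice (a copy of $\mathbf{N}_5$) with $0_{\mathbf{A}}<\gamma<\alpha<\delta$, $0_{\mathbf{A}}<\beta<\delta$, $\alpha\wedge\beta=\gamma\wedge\beta=0_{\mathbf{A}}$, $\alpha\vee\beta=\gamma\vee\beta=\delta$. For $\beta\in\operatorname{Con}(\mathbf{A})$, $\mathbf{A}(\beta)$ is the subalgebra of $\mathbf{A}^2$ with universe $\{(a_0,a_1)\in A^2 : (a_0,a_1)\in\beta\}$. For $\theta\in\operatorname{Con}(\mathbf{A})$ and $i\in\{0,1\}$, $\theta_i$ is the congruence of $\mathbf{A}(\beta)$ given by $\theta_i=\{((a_0,a_1),(b_0,b_1)) : (a_i,b_i)\in\theta\}$. The lattice $\mathbf{M}_1$ is the 11-element lattice with elements $0,e_0,e_1,c_0,c_1,a_0,a_1,b,m,s,d$ and covering relations: $0\prec e_0,e_1,m$; $e_0\prec c_0,b$; $e_1\prec c_1,b$; $m\prec c_0,c_1,s$; $c_0\prec a_0$; $c_1\prec a_1$; $s\prec a_0,a_1$; $a_0,a_1,b\prec d$. The lattice $\mathbf{K}$ is the 14-element lattice with elements $0,e_0,e_1,c_0,c_1,a_0,a_1,b,m,p,q,t,s,d$ and covering relations: $0\prec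 e_0,e_1,m$; $e_0\prec c_0,b$; $e_1\prec c_1,b$; $m\prec p,q$; $p\prec c_0,t$; $q\prec c_1,t$; $t\prec s$; $s\prec a_0,a_1$; $c_0\prec a_0$; $c_1\prec a_1$; $a_0,a_1,b\prec d$. *)

(* Defs.v *)
From HB Require Import structures.
From mathcomp Require Import all_boot all_order.
From mathcomp Require Import boolp classical_sets functions.

Set Implicit Arguments.
Unset Strict Implicit.
Unset Printing Implicit Defensive.
Import Order.Theory.

Local Open Scope classical_set_scope.

Record signature := Signature { symbol : Type; arity : symbol -> nat }.

Record algebra (S : signature) := Algebra {
  carrier :> Type;
  op : forall s : symbol S, ('I_(arity s) -> carrier) -> carrier }.

Arguments op {S} a s x.

Section Algebras.
Context {S : signature}.
Implicit Types A B : algebra S.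

Definition is_hom A B (f : A -> B) : Prop :=
  forall (s : symbol S) (x : 'I_(arity s) -> A),
    f (op A s x) = op B s (fun i => f (x i)).

Definition square A : algebra S :=
  @Algebra S (A * A)%type
    (fun s x => (op A s (fun i => (x i).1), op A s (fun i => (x i).2))).

Definition subuniverse A (U : set A) : Prop :=
  forall (s : symbol S) (x : 'I_(arity s) -> A),
    (forall i, U (x i)) -> U (op A s x).

Definition subalgebra A (U : set A) (hU : subuniverse U) : algebra S :=
  @Algebra S {x : A | U x}
    (fun s x => exist _ (op A s (fun i => sval (x i)))
                      (hU s _ (fun i => svalP (x i)))).

Record is_congruence A (r : set (A * A)) : Prop := IsCongruence {
  congr_refl : forall x, r (x, x);
  congr_sym : forall x y, r (x, y) -> r (y, x);
  congr_trans : forall x y z, r (x, y) -> r (y, z) -> r (x, z);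
  congr_op : forall (s : symbol S) (x y : 'I_(arity s) -> A),
    (forall i, r (x i, y i)) -> r (op A s x, op A s y) }.

Record congruence A := Congruence {
  congr_rel :> set (A * A);
  congruenceP : is_congruence congr_rel }.

Lemma congr_inj A : injective (@congr_rel A).
Proof.
by move=> [r hr] [r' hr'] /= E; subst r'; rewrite (Prop_irrelevance hr hr').
Qed.

Lemma diagonal_congruence A : is_congruence (@diagonal A).
Proof.
split=> [x|x y|x y z|s x y] //=; rewrite /diagonal /=.
- by move=> -> ->.
- by move=> h; have -> : x = y by apply: funext.
Qed.

Lemma setI_congruence A (th ps : congruence A) : is_congruence (th `&` ps).
Proof.
have [r1 s1 t1 o1] := congruenceP th; have [r2 s2 t2 o2] := congruenceP ps.
split=> [x|x y [? ?]|x y z [? ?] [? ?]|s x y h].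
- by split.
- by split; [apply: s1|apply: s2].
- by split; [apply: t1; eassumption|apply: t2; eassumption].
- by split; [apply: o1 => i; case: (h i)|apply: o2 => i; case: (h i)].
Qed.

Lemma smallest_congruence A (r : set (A * A)) :
  is_congruence (smallest (@is_congruence A) r).
Proof.
split=> [x|x y h|x y z h k|s x y h] E [hE rE].
- exact: congr_refl.
- by apply: (congr_sym hE); apply: h.
- by apply: (congr_trans hE (y := y)); [apply: h|apply: k].
- by apply: (congr_op hE) => i; apply: h.
Qed.

Definition congr_bot A := Congruence (diagonal_congruence A).
Definition congr_meet A (th ps : congruence A) :=
  Congruence (setI_congruence th ps).
Definition congr_join A (th ps : congruence A) :=
  Congruence (smallest_congruence (th `|` ps)).
Definition congr_le A (th ps : congruence A) : bool := `[< th `<=` ps >].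

Lemma congr_le_refl A : reflexive (@congr_le A).
Proof. by move=> th; apply/asboolP. Qed.

Lemma congr_le_anti A : antisymmetric (@congr_le A).
Proof.
move=> th ps /andP[/asboolP h1 /asboolP h2].
by apply: congr_inj; apply/seteqP; split.
Qed.

Lemma congr_le_trans A : transitive (@congr_le A).
Proof.
move=> ps th ch /asboolP h1 /asboolP h2.
by apply/asboolP; exact: subset_trans h1 h2.
Qed.

Lemma congr_meetP A (x y z : congruence A) :
  congr_le x (congr_meet y z) = congr_le x y && congr_le x z.
Proof.
apply/asboolP/andP => [h|[/asboolP h1 /asboolP h2] p xp].
  by split; apply/asboolP => p /h [].
by split; [apply: h1|apply: h2].
Qed.

Lemma congr_joinP A (x y z : congruence A) :
  congr_le (congr_join x y) z = congr_le x z && congr_le y z.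
Proof.
apply/asboolP/andP => [h|[/asboolP h1 /asboolP h2]].
  by split; apply/asboolP => p hp; apply: h; apply: sub_gen_smallest;
    [left|right].
by apply: smallest_sub => [|p [/h1|/h2]//]; exact: congruenceP.
Qed.

Lemma congr_le0x A (x : congruence A) : congr_le (congr_bot A) x.
Proof.
apply/asboolP => -[a b]; rewrite /= /diagonal /= => ->.
exact: congr_refl (congruenceP x) b.
Qed.

End Algebras.

Fact congr_display : Order.disp_t. Proof. exact: (Order.Disp tt tt). Qed.

HB.instance Definition _ (S : signature) (A : algebra S) :=
  gen_eqMixin (congruence A).
HB.instance Definition _ (S : signature) (A : algebra S) :=
  gen_choiceMixin (congruence A).
HB.instance Definition _ (S : signature) (A : algebra S) :=
  Order.Le_isPOrder.Build congr_display (congruence A)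
    (@congr_le_refl S A) (@congr_le_anti S A) (@congr_le_trans S A).
HB.instance Definition _ (S : signature) (A : algebra S) :=
  Order.POrder_MeetJoin_isLattice.Build congr_display (congruence A)
    (@congr_meetP S A) (@congr_joinP S A).
HB.instance Definition _ (S : signature) (A : algebra S) :=
  Order.hasBottom.Build congr_display (congruence A) (@congr_le0x S A).

Section CongruenceAlgebra.
Context {S : signature} {A : algebra S}.
Implicit Types beta theta : congruence A.

Lemma congr_subuniverse beta : @subuniverse S (square A) beta.
Proof.
by move=> s x h; apply: (congr_op (congruenceP beta)) => i;
  rewrite -surjective_pairing.
Qed.

(* A(beta), the subalgebra of A^2 with universe beta *)
Definition congr_alg beta : algebra S := subalgebra (@congr_subuniverse beta).

Definition coord0 beta (x : congr_alg beta) : A := (sval x).1.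
Definition coord1 beta (x : congr_alg beta) : A := (sval x).2.

Lemma coord0_hom beta : is_hom (@coord0 beta). Proof. by []. Qed.
Lemma coord1_hom beta : is_hom (@coord1 beta). Proof. by []. Qed.

Lemma preimage_congruence (B : algebra S) (f : B -> A) theta : is_hom f ->
  is_congruence [set xy : B * B | congr_rel theta (f xy.1, f xy.2)].
Proof.
move=> hf; have [r1 s1 t1 o1] := congruenceP theta.
split=> [x|x y|x y z|s x y h] /=.
- exact: r1.
- exact: s1.
- exact: t1.
- by rewrite !hf; exact: o1.
Qed.

(* theta_0 and theta_1 of the algebra A(beta) *)
Definition congr_lift0 beta theta : congruence (congr_alg beta) :=
  Congruence (preimage_congruence theta (@coord0_hom beta)).
Definition congr_lift1 beta theta : congruence (congr_alg beta) :=
  Congruence (preimage_congruence theta (@coord1_hom beta)).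

End CongruenceAlgebra.

Definition rcomp {T : Type} (r s : set (T * T)) : set (T * T) :=
  [set xy | exists2 z, r (xy.1, z) & s (z, xy.2)].

(* These conditions imply that the five elements are distinct and form a
   sublattice: see labelled_pentagon_uniq and labelled_pentagon_sublattice. *)
Record labelled_pentagon d (L : bLatticeType d) (gamma alpha beta delta : L) :
    Prop := LabelledPentagon {
  pentagon_0_gamma : (\bot < gamma)%O;
  pentagon_gamma_alpha : (gamma < alpha)%O;
  pentagon_alpha_delta : (alpha < delta)%O;
  pentagon_0_beta : (\bot < beta)%O;
  pentagon_beta_delta : (beta < delta)%O;
  pentagon_alphaI : (alpha `&` beta)%O = \bot%O;
  pentagon_gammaI : (gamma `&` beta)%O = \bot%O;
  pentagon_alphaU : (alpha `|` beta)%O = delta;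
  pentagon_gammaU : (gamma `|` beta)%O = delta }.

Definition sublattice d (L : latticeType d) (U : set L) : Prop :=
  forall x y, U x -> U y -> U (x `&` y)%O /\ U (x `|` y)%O.

Definition gen_sublattice d (L : latticeType d) (G : set L) : set L :=
  smallest (@sublattice d L) G.

(* For a sublattice U of L: U, with the operations of L, is isomorphic to M. *)
Definition sublattice_iso d d' (L : latticeType d) (U : set L)
    (M : latticeType d') : Prop :=
  exists f : {lmorphism M -> L}, set_bij setT U f.

Lemma labelled_pentagon_uniq d (L : bLatticeType d) (g a b e : L) :
  labelled_pentagon g a b e -> uniq [:: \bot%O; g; a; b; e].
Proof.
case=> g0 ga ae b0 be aI gI aU gU.
have neq_lt (x y : L) : (x < y)%O -> (x == y) = false by move/lt_eqF.
rewrite /= !inE !negb_or (neq_lt _ _ g0) (neq_lt _ _ ga) (neq_lt _ _ ae).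
rewrite (neq_lt _ _ b0) (neq_lt _ _ be) (neq_lt _ _ (lt_trans g0 ga)).
rewrite (neq_lt _ _ (lt_trans b0 be)) (neq_lt _ _ (lt_trans ga ae)) /= !andbT.
apply/andP; split; apply/eqP => E.
  by move: gI g0; rewrite E meetxx => ->; rewrite ltxx.
by move: aI b0; rewrite E meetxx => ->; rewrite ltxx.
Qed.

Lemma labelled_pentagon_sublattice d (L : bLatticeType d) (g a b e : L) :
  labelled_pentagon g a b e -> sublattice [set \bot%O; g; a; b; e].
Proof.
case=> /ltW g0 /ltW ga /ltW ae /ltW b0 /ltW be aI gI aU gU.
have ge := le_trans ga ae.
have sub (x y : L) : (x <= y)%O -> [/\ (x `&` y)%O = x, (y `&` x)%O = x,
    (x `|` y)%O = y & (y `|` x)%O = y].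
  move=> h; rewrite (meetC y) (joinC y).
  by have /meet_idPl -> := h; have /join_idPr -> := h.
have [? ? ? ?] := sub _ _ ga; have [? ? ? ?] := sub _ _ ae.
have [? ? ? ?] := sub _ _ be; have [? ? ? ?] := sub _ _ ge.
have bg : (b `&` g)%O = \bot%O by rewrite meetC.
have ba : (b `&` a)%O = \bot%O by rewrite meetC.
have bgU : (b `|` g)%O = e by rewrite joinC.
have baU : (b `|` a)%O = e by rewrite joinC.
by move=> x y [[[[->|->]|->]|->]|->] [[[[->|->]|->]|->]|->] /=;
  split; rewrite ?(meet0x, meetx0, join0x, joinx0, meetxx, joinxx);
  repeat match goal with H : ?l = _ |- context [?l] => rewrite H end;
  tauto.
Qed.

(* [up x] lists the upper covers of [x] and the order is
   [connect (grel up)].  [reach n] is a computable form of that order;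
   [hasse_glb] and [hasse_lub] find the greatest lower and least upper bounds
   by search among the elements of [s]. *)
Section Hasse.
Variables (T : finType) (s : seq T) (up : T -> seq T).

Fixpoint reach (n : nat) (x y : T) : bool :=
  (x == y) || (if n is n'.+1 then has (fun z => reach n' z y) (up x)
               else false).

Let le := reach (size s).

Definition hasse_glb (x y : T) : T :=
  head x [seq z <- s | [&& le z x, le z y &
                        all (fun w => le w x && le w y ==> le w z) s]].

Definition hasse_lub (x y : T) : T :=
  head x [seq z <- s | [&& le x z, le y z &
                        all (fun w => le x w && le y w ==> le z w) s]].

Definition hasse_ok : bool :=
  all (fun x => all (fun y => all (fun z =>
    [&& (z \in up x) && le z y ==> le x y,
        le x y && le y x ==> (x == y),
        le x (hasse_glb y z) == le x y && le x z,
        le (hasse_lub x y) z == le x z && le y z &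
        (* the pairs listed by [up] are coverings in the resulting order *)
        (y \in up x) ==> [&& le x y, x != y &
          le x z && le z y ==> (z == x) || (z == y)]]) s) s) s.

Hypothesis s_complete : forall x, x \in s.
Hypothesis ok : hasse_ok.

Let okP x y z := allP (allP (allP ok x (s_complete x)) y (s_complete y))
  z (s_complete z).

Lemma connect_reach : connect (grel up) =2 le.
Proof.
move=> x y; apply/idP/idP.
  case/connectP => p + ->; elim: p x => [|z p IH] x /=.
    by move=> _; rewrite /le; case: (size s) => /= *; rewrite eqxx.
  case/andP => xz /IH h.
  by have /and5P[/implyP + _ _ _ _] := okP x (last z p) z; apply; apply/andP.
rewrite /le; elim: (size s) x => [|n IH] x /=.
  by rewrite orbF => /eqP ->.
case/orP => [/eqP -> //|/hasP[z xz /IH]].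
by apply: connect_trans; apply: connect1.
Qed.

Lemma hasse_anti : antisymmetric (connect (grel up)).
Proof.
move=> x y; rewrite !connect_reach => h.
by have /and5P[_ /implyP/(_ h)/eqP + _ _ _] := okP x y x.
Qed.

Lemma hasse_glbP x y z : connect (grel up) x (hasse_glb y z) =
  connect (grel up) x y && connect (grel up) x z.
Proof.
by rewrite !connect_reach; have /and5P[_ _ /eqP + _ _] := okP x y z.
Qed.

Lemma hasse_lubP x y z : connect (grel up) (hasse_lub x y) z =
  connect (grel up) x z && connect (grel up) y z.
Proof.
by rewrite !connect_reach; have /and5P[_ _ _ /eqP + _] := okP x y z.
Qed.

Lemma hasse_cover x y : y \in up x ->
  [/\ connect (grel up) x y, x != y &
   forall z, connect (grel up) x z -> connect (grel up) z y ->
     z = x \/ z = y].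
Proof.
rewrite connect_reach => xy.
have H z : [&& le x y, x != y & le x z && le z y ==> (z == x) || (z == y)].
  by have /and5P[_ _ _ _ /implyP/(_ xy)] := okP x y z.
split=> [||z]; [by case/and3P: (H x)|by case/and3P: (H x)|].
rewrite !connect_reach => xz zy.
case/and3P: (H z) => _ _; rewrite xz zy => /orP[/eqP|/eqP]; first by left.
by right.
Qed.

End Hasse.

Fact hasse_display : Order.disp_t. Proof. exact: (Order.Disp tt tt). Qed.

Inductive lattice_M1 : predArgType :=
  | M1_0 | M1_e0 | M1_e1 | M1_c0 | M1_c1 | M1_a0 | M1_a1 | M1_b | M1_m
  | M1_s | M1_d.

Definition M1_elems : seq lattice_M1 :=
  [:: M1_0; M1_e0; M1_e1; M1_c0; M1_c1; M1_a0; M1_a1; M1_b; M1_m; M1_s;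
      M1_d].

Definition M1_covers (x : lattice_M1) : seq lattice_M1 :=
  match x with
  | M1_0 => [:: M1_e0; M1_e1; M1_m]
  | M1_e0 => [:: M1_c0; M1_b]
  | M1_e1 => [:: M1_c1; M1_b]
  | M1_c0 => [:: M1_a0]
  | M1_c1 => [:: M1_a1]
  | M1_a0 => [:: M1_d]
  | M1_a1 => [:: M1_d]
  | M1_b => [:: M1_d]
  | M1_m => [:: M1_c0; M1_c1; M1_s]
  | M1_s => [:: M1_a0; M1_a1]
  | M1_d => [::]
  end.

Definition M1_code (x : lattice_M1) : nat :=
  match x with
  | M1_0 => 0 | M1_e0 => 1 | M1_e1 => 2 | M1_c0 => 3 | M1_c1 => 4
  | M1_a0 => 5 | M1_a1 => 6 | M1_b => 7 | M1_m => 8 | M1_s => 9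
  | M1_d => 10
  end.

Lemma M1_codeK : cancel M1_code (nth M1_0 M1_elems).
Proof. by case. Qed.

HB.instance Definition _ := Countable.copy lattice_M1 (can_type M1_codeK).

Lemma M1_elemsP : Finite.axiom M1_elems. Proof. by case. Qed.

HB.instance Definition _ := isFinite.Build lattice_M1 M1_elemsP.

Lemma M1_elems_complete (x : lattice_M1) : x \in M1_elems. Proof. by case: x. Qed.

Lemma M1_ok : hasse_ok M1_elems M1_covers.
Proof. by vm_compute. Qed.

HB.instance Definition _ := Order.Le_isPOrder.Build hasse_display lattice_M1
  (@connect0 _ (grel M1_covers)) (hasse_anti M1_elems_complete M1_ok)
  (@connect_trans _ (grel M1_covers)).
HB.instance Definition _ := Order.POrder_MeetJoin_isLattice.Build
  hasse_display lattice_M1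
  (hasse_glbP M1_elems_complete M1_ok) (hasse_lubP M1_elems_complete M1_ok).

Inductive lattice_K : predArgType :=
  | K_0 | K_e0 | K_e1 | K_c0 | K_c1 | K_a0 | K_a1 | K_b | K_m | K_p | K_q
  | K_t | K_s | K_d.

Definition K_elems : seq lattice_K :=
  [:: K_0; K_e0; K_e1; K_c0; K_c1; K_a0; K_a1; K_b; K_m; K_p; K_q; K_t;
      K_s; K_d].

Definition K_covers (x : lattice_K) : seq lattice_K :=
  match x with
  | K_0 => [:: K_e0; K_e1; K_m]
  | K_e0 => [:: K_c0; K_b]
  | K_e1 => [:: K_c1; K_b]
  | K_c0 => [:: K_a0]
  | K_c1 => [:: K_a1]
  | K_a0 => [:: K_d]
  | K_a1 => [:: K_d]
  | K_b => [:: K_d]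
  | K_m => [:: K_p; K_q]
  | K_p => [:: K_c0; K_t]
  | K_q => [:: K_c1; K_t]
  | K_t => [:: K_s]
  | K_s => [:: K_a0; K_a1]
  | K_d => [::]
  end.

Definition K_code (x : lattice_K) : nat :=
  match x with
  | K_0 => 0 | K_e0 => 1 | K_e1 => 2 | K_c0 => 3 | K_c1 => 4 | K_a0 => 5
  | K_a1 => 6 | K_b => 7 | K_m => 8 | K_p => 9 | K_q => 10 | K_t => 11
  | K_s => 12 | K_d => 13
  end.

Lemma K_codeK : cancel K_code (nth K_0 K_elems).
Proof. by case. Qed.

HB.instance Definition _ := Countable.copy lattice_K (can_type K_codeK).

Lemma K_elemsP : Finite.axiom K_elems. Proof. by case. Qed.

HB.instance Definition _ := isFinite.Build lattice_K K_elemsP.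

Lemma K_elems_complete (x : lattice_K) : x \in K_elems. Proof. by case: x. Qed.

Lemma K_ok : hasse_ok K_elems K_covers.
Proof. by vm_compute. Qed.

HB.instance Definition _ := Order.Le_isPOrder.Build hasse_display lattice_K
  (@connect0 _ (grel K_covers)) (hasse_anti K_elems_complete K_ok)
  (@connect_trans _ (grel K_covers)).
HB.instance Definition _ := Order.POrder_MeetJoin_isLattice.Build
  hasse_display lattice_K
  (hasse_glbP K_elems_complete K_ok) (hasse_lubP K_elems_complete K_ok).

(* Main.v *)
From HB Require Import structures.
Require Import Defs.
From mathcomp Require Import all_boot all_order.
From mathcomp Require Import boolp classical_sets functions.

Set Implicit Arguments.
Unset Strict Implicit.
Unset Printing Implicit Defensive.
Import Order.Theory.

(* Write e_i, c_i, a_i for the lifts of 0, gamma, alpha.  The congruences of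
   A(beta) above e_i are exactly the lifts theta_i, each determined by its trace
   on the diagonal; hence e_0 \/ e_1 = b = beta_i, e_i \/ (theta_0 /\ theta_1) =
   theta_i and the joins with the c_i are computed in Con(A).  The elements
   p = c_0 /\ a_1 and q = c_1 /\ a_0 equal m = c_0 /\ c_1 exactly when
   (beta o gamma o beta) /\ alpha is contained in gamma, which gives M_1.
   Otherwise c_0 \/ q = a_0 and c_1 \/ p = a_1 because [gamma, alpha] has only
   two elements, and t = p \/ q stays below s = a_0 /\ a_1 because a chain of p-
   and q-steps that starts on the diagonal stays on it and moves only within a
   gamma-class; this gives K.
   That the resulting maps are lattice embeddings is checked on covers only. *)

Local Open Scope classical_set_scope.
Local Open Scope order_scope.

(** * Maps out of a finite lattice *)

Section FiniteLattices.
Context {d d' : Order.disp_t} {M : finLatticeType d} {L : latticeType d'}.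
Variable e : rel M.
Hypothesis leE : forall x y : M, (x <= y) = connect e x y.

(** A shortened path never returns to x, so its first edge goes strictly up even if [e] has
    loops. *)
Lemma edge_above (x y : M) : x < y -> exists2 z, e x z & x < z <= y.
Proof.
rewrite lt_neqAle leE => /andP[xy /connectP[p]].
case/shortenP => -[|z p'] /= ep up _ yE; first by rewrite yE eqxx in xy.
case/andP: ep => xz ep; case/andP: up => + _; rewrite inE negb_or => /andP[xz' _].
exists z => //; rewrite lt_neqAle xz' !leE connect1 //=.
by apply/connectP; exists p'.
Qed.

Lemma homo_of_edges (f : M -> L) :
  (forall x y, e x y -> f x <= f y) -> {homo f : x y / x <= y}.
Proof.
move=> fe x y; rewrite leE => /connectP[p + ->].
elim: p x => //= z p IH x /andP[/fe xz /IH]; exact: le_trans.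
Qed.

(* Upward induction on a common lower bound w of y and z: if w lies below y
   and z, take edges from w to y' <= y and z' <= z; then y and y' \/ z' are
   both above y', and y \/ z' and z are both above z'. *)
Lemma join_morph_of_edges (f : M -> L) : {homo f : x y / x <= y} ->
  (forall x y z, e x y -> e x z -> f (y `|` z) <= f y `|` f z) ->
  {morph f : x y / x `|` y}.
Proof.
move=> fle fe.
suff main n (w y z : M) : (#|[pred t | (w < t)%O]| < n)%N -> w <= y -> w <= z ->
    f (y `|` z) <= f y `|` f z.
  move=> y z; apply: le_anti; rewrite leUx !fle ?leUl ?leUr ?andbT //.
  by apply: (main _ (y `&` z) _ _ (leqnn _)); rewrite ?leIl ?leIr.
elim: n w y z => // n IH w y z; rewrite ltnS => wn.
rewrite le_eqVlt => /orP[/eqP <- wz|wy]; first by rewrite join_r // leUr.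
rewrite le_eqVlt => /orP[/eqP <-|wz]; first by rewrite join_l ?leUl // ltW.
have up t u v : w < t -> t <= u -> t <= v -> f (u `|` v) <= f u `|` f v.
  move=> wt; apply: (IH t); apply: leq_trans wn; apply/proper_card/properP.
  split; first by apply/fintype.subsetP => k; rewrite !inE; apply: lt_trans.
  by exists t; rewrite !inE ?ltxx.
have [y' ey /andP[wy' yy]] := edge_above wy.
have [z' ez /andP[wz' zz]] := edge_above wz.
have h1 : f (y `|` z') <= f y `|` f z'.
  rewrite -(join_l yy) -joinA; apply: le_trans (up _ _ _ wy' yy (leUl _ _)) _.
  rewrite (join_l yy) leUx leUl (le_trans (fe _ _ _ ey ez)) // leU2 // fle //.
rewrite -(join_r zz) joinA; apply: le_trans (up _ _ _ wz' (leUr _ _) zz) _.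
rewrite (join_r zz) leUx leUr andbT (le_trans h1) // leU2 // fle //.
Qed.

End FiniteLattices.

Section FiniteLatticeEmbeddings.
Context {d d' : Order.disp_t} {M : finLatticeType d} {L : latticeType d'}.
Variable e : rel M.
Hypothesis leE : forall x y : M, (x <= y) = connect e x y.

Let ge_connect (x y : M^d) : (x <= y) = connect [rel x y | e y x] x y.
Proof. by rewrite connect_rev; apply: (leE y x). Qed.

Lemma edge_below (x y : M) : x < y -> exists2 z, e z y & x <= z < y.
Proof.
by case/(@edge_above _ M^d _ ge_connect y x) => z ez zz; exists z; rewrite // andbC.
Qed.

(** The join criterion applied to the dual lattices, whose edges are the reversed ones. *)
Lemma meet_morph_of_edges (f : M -> L) : {homo f : x y / x <= y} ->
  (forall x y z, e y x -> e z x -> f y `&` f z <= f (y `&` z)) ->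
  {morph f : x y / x `&` y}.
Proof.
move=> fle fe.
by apply: (@join_morph_of_edges _ _ M^d L^d _ ge_connect f) => // x y; apply: fle.
Qed.

Hypothesis edge_cover : forall x y, e x y ->
  x < y /\ forall z, x <= z -> z <= y -> z = x \/ z = y.

(* The hypothesis says that y is join irreducible and x its lower cover. *)
Lemma inj_of_edges (f : {lmorphism M -> L}) :
  (forall x y, e x y -> (forall z, e z y -> z = x) -> f x <> f y) ->
  injective f.
Proof.
move=> fe.
(* [f] reflects the order, by induction on the number of elements strictly below y. If y is not
   below x, all elements strictly below y lie below x, so x /\ y is the only lower cover of y; but f
   y <= f x makes [f] identify it with y. *)
suff main n (y x : M) : (#|[pred t | (t < y)%O]| < n)%N -> f y <= f x -> y <= x.
  by move=> x y fxy; apply: le_anti; rewrite !(main _ _ _ (leqnn _)) // fxy.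
elim: n y x => // n IH y x; rewrite ltnS => yn fyx.
have [//|yx] := boolP (y <= x).
have below z : z < y -> z <= x.
  move=> zy; apply: IH (le_trans (omorph_le f (ltW zy)) fyx).
  apply: leq_trans yn; apply/proper_card/properP.
  split; last by exists z; rewrite !inE ?ltxx.
  by apply/fintype.subsetP => k; rewrite !inE => /lt_trans; apply.
have xy : x `&` y < y.
  by rewrite lt_neqAle leIr andbT; apply: contra yx => /eqP <-; apply: leIl.
have [k eky /andP[xk ky]] := edge_below xy.
have kE : k = x `&` y by apply: le_anti; rewrite xk lexI below // ltW.
case: (fe k y eky) => [z ezy|]; last first.
  by rewrite kE omorphI meet_r.
have [zy /(_ k)] := edge_cover ezy.
rewrite {1}kE lexI below // ltW //= => /(_ isT (ltW ky))[] //.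
by move=> kE'; rewrite kE' ltxx in ky.
Qed.

End FiniteLatticeEmbeddings.

Section SublatticeIso.
Context {d d' : Order.disp_t} {M : finLatticeType d} {L : latticeType d'}.
Variable e : rel M.
Hypothesis leE : forall x y : M, (x <= y) = connect e x y.
Hypothesis edge_cover : forall x y, e x y ->
  [/\ x <= y, x != y & forall z, x <= z -> z <= y -> z = x \/ z = y].

(* code only selects one of the two orders of each pair of covers. *)
Lemma sublattice_iso_of_edges (code : M -> nat) (f : M -> L) (G : set L) :
  injective code ->
  (forall x y, e x y -> f x <= f y) ->
  (forall x y z, e x y -> e x z -> (code y < code z)%N ->
    f (y `|` z) <= f y `|` f z) ->
  (forall x y z, e y x -> e z x -> (code y < code z)%N ->
    f y `&` f z <= f (y `&` z)) ->
  (forall x y, e x y -> (forall z, e z y -> z = x) -> f x <> f y) ->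
  (forall x, gen_sublattice G (f x)) -> G `<=` range f ->
  sublattice_iso (gen_sublattice G) M.
Proof.
move=> code_inj fe fU fI f_inj fG Gf.
have fle := homo_of_edges leE fe.
have fU' : {morph f : x y / x `|` y}.
  apply: (join_morph_of_edges leE fle) => x y z xy xz.
  have [|| /code_inj ->] := ltngtP (code y) (code z); first exact: fU xy xz.
    by rewrite (joinC y) (joinC (f y)); exact: fU xz xy.
  by rewrite !joinxx.
have fI' : {morph f : x y / x `&` y}.
  apply: (meet_morph_of_edges leE fle) => x y z yx zx.
  have [|| /code_inj ->] := ltngtP (code y) (code z); first exact: fI yx zx.
    by rewrite (meetC y) (meetC (f y)); exact: fI zx yx.
  by rewrite !meetxx.
pose fo := Order.isOrderMorphism.Build _ _ _ _ f fle.
pose fm := Order.isMeetLatticeMorphism.Build _ _ _ _ f fI'.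
pose fj := Order.isJoinLatticeMorphism.Build _ _ _ _ f fU'.
pose F : {lmorphism M -> L} := HB.pack f fo fm fj.
exists F; split=> [x _|x y _ _|]; first exact: fG.
  apply: (inj_of_edges leE _ (f := F) f_inj) => {}x {}y /edge_cover[xy xy' ?].
  by split=> //; rewrite lt_neqAle xy'.
apply: (smallest_sub _ Gf) => _ _ [x _ <-] [y _ <-].
by split; [exists (x `&` y)|exists (x `|` y)] => //; rewrite ?omorphI ?omorphU.
Qed.

End SublatticeIso.

(** Both maps have image U, so choosing preimages gives an injection of M into N. *)
Lemma card_le_of_sublattice_iso d d1 d2 (L : latticeType d) (U : set L)
  (M : finLatticeType d1) (N : finLatticeType d2) :
  sublattice_iso U M -> sublattice_iso U N -> (#|M| <= #|N|)%N.
Proof.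
move=> [f [fU f_inj _]] [g [_ _ gU]].
have /choice[h hP] : forall x, exists y, g y = f x.
  by move=> x; have [y _ <-] := gU _ (fU x I); exists y.
apply: (leq_card h) => x y hxy.
by apply: f_inj; rewrite ?in_setT // -!hP hxy.
Qed.

(** * Congruences of A(beta) *)

Section Congruences.
Context {S : signature} {A : algebra S}.
Implicit Types th ps : congruence A.

Lemma congr_leP th ps :
  reflect (forall x y, congr_rel th (x, y) -> congr_rel ps (x, y)) (th <= ps).
Proof. by apply: (iffP (asboolP _)) => [h x y /h //|h [x y] /h]. Qed.

Lemma congr_le_rel th ps x y :
  th <= ps -> congr_rel th (x, y) -> congr_rel ps (x, y).
Proof. by move/congr_leP; apply. Qed.

(* The elements not separated by a set closed under both congruences form a
   congruence: compatibility with an operation is checked by changing one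
   argument at a time. *)
Lemma join_ind th ps (U : set A) (x y : A) :
  (forall u v, U u -> congr_rel th (u, v) \/ congr_rel ps (u, v) -> U v) ->
  congr_rel (th `|` ps) (x, y) -> U x -> U y.
Proof.
pose closed (V : set A) :=
  forall u v, congr_rel th (u, v) \/ congr_rel ps (u, v) -> V u -> V v.
pose R := [set xy : A * A | forall V, closed V -> V xy.1 <-> V xy.2].
have sym u v : congr_rel th (u, v) \/ congr_rel ps (u, v) ->
    congr_rel th (v, u) \/ congr_rel ps (v, u).
  by case=> /(congr_sym (congruenceP _)) ?; [left|right].
have R_congr : is_congruence R.
  split=> [u V //|u v h V cV|u v w h k V cV|s u v h V cV] /=.
    by rewrite (h V cV).
    by rewrite (h V cV) (k V cV).
  pose z (k : nat) (i : 'I_(arity s)) := if (i < k)%N then v i else u i.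
  have zE k : (k <= arity s)%N -> V (op A s u) <-> V (op A s (z k)).
    elim: k => [|k IH] ka; first by have -> : z 0%N = u by apply: funext.
    rewrite (IH (ltnW ka)).
    pose i0 := Ordinal ka.
    pose w a i := if i == i0 then a else z k i.
    have -> : z k = w (u i0).
      apply: funext => i; rewrite /w; case: eqP => // ->.
      by rewrite /z ltnn.
    have -> : z k.+1 = w (v i0).
      apply: funext => i; rewrite /w /z ltnS leq_eqVlt -(inj_eq val_inj) /=.
      by case: eqP => //= E; congr v; apply: val_inj.
    (* The preimage of V under the unary polynomial that varies only argument [i0] is again
       closed. *)
    apply: (h i0 [set a | V (op A s (w a))]) => a b ab /=; apply: cV.
    case: ab => ab; [left|right]; apply: congr_op (congruenceP _) _ _ _ _ => i;
      rewrite /w; case: eqP => // _; exact: congr_refl (congruenceP _) _.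
  rewrite (zE (arity s)) //; have -> // : z (arity s) = v.
  by apply: funext => i; rewrite /z ltn_ord.
move=> cU /(_ R) h; have {}h : R (x, y).
  apply: h; split=> // -[u v] uv V cV.
  by split; apply: cV => //; apply: sym.
by apply: (h U _).1 => u v uv Uu; apply: cU Uu uv.
Qed.

End Congruences.

(** * Lifts of congruences of A to A(beta) *)

Section CongruenceLifts.
Context {S : signature} {A : algebra S} (beta : congruence A).
Implicit Types th ps : congruence A.

(** A boolean index lets one statement serve both coordinates, [~~ i] being the other one. *)
Definition coord (i : bool) (x : congr_alg beta) : A :=
  if i then coord1 x else coord0 x.

Definition congr_lift (i : bool) th : congruence (congr_alg beta) :=
  if i then congr_lift1 beta th else congr_lift0 beta th.

Definition diag_elem (a : A) : congr_alg beta :=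
  exist _ (a, a) (congr_refl (congruenceP beta) a).

Lemma diag_hom : is_hom diag_elem.
Proof. by move=> s x; apply: eq_exist. Qed.

Definition diag_congr (chi : congruence (congr_alg beta)) : congruence A :=
  Congruence (preimage_congruence chi diag_hom).

Lemma congr_liftE i th x y :
  congr_rel (congr_lift i th) (x, y) = congr_rel th (coord i x, coord i y).
Proof. by case: i. Qed.

Lemma coord_diag i a : coord i (diag_elem a) = a. Proof. by case: i. Qed.

Lemma coord_beta i j x : congr_rel beta (coord i x, coord j x).
Proof.
have [r s _ _] := congruenceP beta; case: x => -[a b] h; move: (h).
by case: i; case: j => //= ?; exact: s.
Qed.

(* x and (x_i, x_i) have the same i-th coordinate, so chi is determined by its
   restriction to the diagonal. *)
Lemma lift_diag i (chi : congruence (congr_alg beta)) :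
  congr_lift i \bot <= chi -> congr_lift i (diag_congr chi) = chi.
Proof.
move=> /congr_leP h; have [r s t _] := congruenceP chi.
have dg x : congr_rel chi (x, diag_elem (coord i x)).
  by apply: h; rewrite congr_liftE coord_diag.
apply: le_anti; apply/andP; split; apply/congr_leP => x y; rewrite congr_liftE.
  by move=> xy; apply: t (dg x) (t _ _ _ xy (s _ _ (dg y))).
by move=> xy; apply: t (s _ _ (dg x)) (t _ _ _ xy (dg y)).
Qed.

Lemma lift_le i th ps : (congr_lift i th <= congr_lift i ps) = (th <= ps).
Proof.
apply/congr_leP/congr_leP => h x y; last by rewrite !congr_liftE; apply: h.
by have := h (diag_elem x) (diag_elem y); rewrite !congr_liftE !coord_diag.
Qed.

Lemma lift_inj i : injective (congr_lift i).
Proof.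
by move=> th ps E; apply: le_anti; rewrite -!(lift_le i) E lexx.
Qed.

Lemma liftI i th ps :
  congr_lift i (th `&` ps) = congr_lift i th `&` congr_lift i ps.
Proof. by case: i; apply: congr_inj. Qed.

(** The join of the lifts lies above e_i, hence is itself a lift, and lifts compare as in Con(A). *)
Lemma liftU i th ps :
  congr_lift i (th `|` ps) = congr_lift i th `|` congr_lift i ps.
Proof.
have h : congr_lift i \bot <= congr_lift i th `|` congr_lift i ps.
  by apply: le_trans (leUl _ _); rewrite lift_le le0x.
apply: le_anti; rewrite leUx !lift_le leUl leUr andbT.
by rewrite -(lift_diag h) lift_le leUx -!(lift_le i) (lift_diag h) leUl leUr.
Qed.

(** The two coordinates of an element of A(beta) are beta-related, so modulo such a congruence
    either one may be read. *)
Lemma lift_above_beta i j th :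
  beta <= th -> congr_lift i th = congr_lift j th.
Proof.
move=> bth; have [_ _ t _] := congruenceP th.
have sub i' j' : congr_lift i' th <= congr_lift j' th.
  apply/congr_leP => x y; rewrite !congr_liftE => xy.
  apply: t (congr_le_rel bth (coord_beta j' i' x)) (t _ _ _ xy _).
  exact: congr_le_rel bth (coord_beta i' j' y).
by apply: le_anti; rewrite !sub.
Qed.

Lemma lift_le_above_beta i j th ps :
  th <= ps -> beta <= ps -> congr_lift i th <= congr_lift j ps.
Proof. by move=> tp /(lift_above_beta i j) <-; rewrite lift_le. Qed.

Lemma lift_botI i : congr_lift i \bot `&` congr_lift (~~ i) \bot = \bot.
Proof.
apply: le_anti; rewrite le0x andbT; apply/congr_leP => x y -[].
rewrite !congr_liftE /= /diagonal /= /coord /coord0 /coord1.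
by case: x y i => -[a b] h [[a' b'] h'] [] /= ab ab'; apply: eq_exist;
  rewrite ab ab'.
Qed.

Lemma lift_botU i : congr_lift i \bot `|` congr_lift (~~ i) \bot =
  congr_lift i beta.
Proof.
apply: le_anti; rewrite leUx lift_le le0x (lift_above_beta i (~~ i)) //.
rewrite lift_le le0x /= (lift_above_beta (~~ i) i) //.
rewrite -[leRHS](@lift_diag i) ?leUl // lift_le; apply/congr_leP => a b ab.
have [_ _ t _] := congruenceP (congr_lift i \bot `|` congr_lift (~~ i) \bot).
(* For i = 0, the element (a, b) shares coordinate 0 with (a, a) and coordinate 1 with (b, b), so it
   links the two; for i = 1 the pair is reversed. *)
have ab' : congr_rel beta (if i then (b, a) else (a, b)).
  by case: i {t} => //; apply: congr_sym ab; apply: congruenceP.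
apply: (t _ (exist _ _ ab')).
  by apply: congr_le_rel (leUl _ _) _; case: i {t} ab'.
by apply: congr_le_rel (leUr _ _) _; case: i {t} ab'.
Qed.

(** Modulo e_i every element may be replaced by a diagonal one, and on the diagonal both lifts
    agree. *)
Lemma lift_bot_join i th : congr_lift i \bot `|`
  (congr_lift i th `&` congr_lift (~~ i) th) = congr_lift i th.
Proof.
apply: le_anti; rewrite leUx leIl lift_le le0x /=.
rewrite -[leRHS](@lift_diag i) ?leUl // lift_le; apply/congr_leP => a b ab.
by apply: congr_le_rel (leUr _ _) _; split;
  rewrite congr_liftE !coord_diag.
Qed.

End CongruenceLifts.

Arguments congr_lift : simpl never.

(** * The sublattice generated by a pentagon *)

Section Pentagon.
Context {S : signature} {A : algebra S}.
Context {alpha beta gamma delta : congruence A}.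
Hypothesis pentagon : labelled_pentagon gamma alpha beta delta.
Hypothesis interval_eq :
  [set theta : congruence A | (gamma <= theta <= alpha)%O] = [set gamma; alpha].
Local Notation lift := (congr_lift beta).

Let le_ga : gamma <= alpha. Proof. exact: ltW (pentagon_gamma_alpha pentagon). Qed.
Let le_bd : beta <= delta. Proof. exact: ltW (pentagon_beta_delta pentagon). Qed.

Lemma lift_beta_join i : lift i beta <= lift i \bot `|` lift (~~ i) \bot.
Proof. by rewrite lift_botU. Qed.

Lemma lift_gamma_betaU i : lift i delta <= lift i gamma `|` lift i beta.
Proof. by rewrite -liftU (pentagon_gammaU pentagon). Qed.

Lemma lift_delta_le i th : th `|` beta = delta ->
  lift i delta <= lift i th `|` lift (~~ i) th.
Proof.
move=> <-; rewrite liftU leUx leUl /=.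
by apply: le_trans (lift_beta_join i) (leU2 _ _); rewrite lift_le le0x.
Qed.

Lemma lift_alpha_betaI i : lift i alpha `&` lift i beta <= lift i \bot.
Proof. by rewrite -liftI (pentagon_alphaI pentagon). Qed.

(** With j the other coordinate, e_i lies below beta_j, and alpha_j /\ beta_j = e_j; finally e_0 /\
    e_1 = 0. *)
Lemma lift_bot_alphaI i : lift i \bot `&` lift (~~ i) alpha = \bot.
Proof.
apply: le_anti; rewrite le0x andbT -[leRHS](lift_botI beta i) lexI leIl /=.
apply: le_trans (lift_alpha_betaI _); rewrite meetC leI2 //.
by rewrite (lift_above_beta (~~ i) i) // lift_le le0x.
Qed.

Lemma lift_bot_neq i : lift i \bot <> \bot.
Proof.
move=> E; have := lift_botU beta i; rewrite E join0x.
rewrite (lift_above_beta i (~~ i)) // => /lift_inj b0.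
by have := pentagon_0_beta pentagon; rewrite -b0 ltxx.
Qed.

(** Joining with e_i recovers gamma_i from the meet, so a zero meet would force gamma = 0. *)
Lemma lift_gammaI_neq i : lift i gamma `&` lift (~~ i) gamma <> \bot.
Proof.
move=> E; have := lift_bot_join beta i gamma; rewrite E joinx0 => /lift_inj g0.
by have := pentagon_0_gamma pentagon; rewrite -g0 ltxx.
Qed.

Lemma lift_gamma_alphaIU i : lift i alpha <=
  lift i gamma `|` (lift i alpha `&` lift (~~ i) alpha).
Proof. by rewrite -[leLHS]lift_bot_join leU2 // lift_le le0x. Qed.

Lemma lift_gammaI_neq_alphaI i : lift i gamma `&` lift (~~ i) gamma <>
  lift i alpha `&` lift (~~ i) alpha.
Proof.
move=> E; have := lift_bot_join beta i gamma; rewrite E lift_bot_join.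
by move=> /lift_inj ga; have := pentagon_gamma_alpha pentagon; rewrite ga ltxx.
Qed.

(* Pairs (x, y) in gamma_i /\ alpha_j with i <> j correspond to chains
   x_j beta x_i gamma y_i beta y_j with x_j alpha y_j. *)
Lemma lift_gamma_alphaI_le i :
  (lift i gamma `&` lift (~~ i) alpha <= lift (~~ i) gamma) <->
  (rcomp (rcomp beta gamma) beta `&` alpha `<=` gamma)%classic.
Proof.
split=> [/congr_leP h [a b] [[c [c' ac' c'c] cb] ab]|h].
  have bsym := congr_sym (congruenceP beta).
  (* For i = 0 the elements are (c', a) and (c, b): coordinate 0 carries the gamma-step, coordinate
     1 the alpha-step. *)
  have xP : congr_rel beta (if i then (a, c') else (c', a)).
    by case: i {h} => //; apply: bsym.
  have yP : congr_rel beta (if i then (b, c) else (c, b)).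
    by case: i {h xP} => //; apply: bsym.
  by have := h (exist _ _ xP) (exist _ _ yP); case: i {h} xP yP => xP yP; apply.
apply/congr_leP => x y []; rewrite !congr_liftE => g a; apply: h; split=> //.
exists (coord i y); last exact: coord_beta.
by exists (coord i x) => //; apply: coord_beta.
Qed.

(** The join is the lift of its diagonal trace, which lies in [gamma, alpha]; it cannot be gamma, so
    it is alpha. *)
Lemma lift_gamma_alphaI_join i :
  ~ (lift i gamma `&` lift (~~ i) alpha <= lift (~~ i) gamma) ->
  lift (~~ i) alpha <=
    lift (~~ i) gamma `|` (lift i gamma `&` lift (~~ i) alpha).
Proof.
set q := _ `&` _; set u := _ `|` q => nle.
have uE : lift (~~ i) (diag_congr u) = u.
  by apply: lift_diag; apply: le_trans (leUl _ _); rewrite lift_le le0x.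
have : [set th | gamma <= th <= alpha]%classic (diag_congr u).
  rewrite /= -!(lift_le beta (~~ i)) uE leUl leUx lift_le le_ga leIr //.
rewrite interval_eq => -[]E; move: uE; rewrite E => uE; last by rewrite -uE.
by case: nle; rewrite uE leUr.
Qed.

(* Since alpha /\ beta = 0, a chain in gamma_0 /\ alpha_1 and
   alpha_0 /\ gamma_1 that starts on the diagonal stays on it. *)
Lemma lift_gamma_alphaIU_neq :
  lift false gamma `&` lift true alpha `|` lift true gamma `&` lift false alpha
    <> lift false alpha `&` lift true alpha.
Proof.
move=> E; suff : alpha <= gamma by rewrite (lt_geF (pentagon_gamma_alpha pentagon)).
apply/congr_leP => a b ab.
have [rg _ tg _] := congruenceP gamma; have [_ sa ta _] := congruenceP alpha.
pose U := [set z : congr_alg beta |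
  coord false z = coord true z /\ congr_rel gamma (a, coord false z)].
have : congr_rel (lift false alpha `&` lift true alpha)
    (diag_elem beta a, diag_elem beta b).
  by split; rewrite congr_liftE !coord_diag.
rewrite -E => /(@join_ind _ _ _ _ U)[||//] => [u v|]; last first.
  by split=> //; exact: rg.
move=> [uE au] uv.
(* As gamma <= alpha, both coordinates move inside an alpha-class; u being diagonal, those of v are
   related by alpha and by beta. *)
have vE : coord false v = coord true v.
  have vb := coord_beta false true v.
  have : congr_rel (alpha `&` beta) (coord false v, coord true v).
    split=> //; suff [h0 h1] : congr_rel alpha (coord false u, coord false v)
        /\ congr_rel alpha (coord true u, coord true v).
      by apply: ta (sa _ _ h0) _; rewrite uE.
    by case: uv => -[]; rewrite !congr_liftE => h h'; split=> //;
      apply: congr_le_rel le_ga _.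
  by rewrite (pentagon_alphaI pentagon).
split=> //; apply: tg au _.
by case: uv => -[]; rewrite !congr_liftE // uE vE.
Qed.

(** * Membership in the generated sublattice *)

Definition pentagon_gens : set (congruence (congr_alg beta)) :=
  [set lift false alpha; lift true alpha; lift false gamma; lift true gamma;
       lift false beta]%classic.

Let gen := gen_sublattice pentagon_gens.

Lemma gen_pentagon x : pentagon_gens x -> gen x.
Proof. exact: sub_gen_smallest. Qed.

Lemma gen_pentagonI x y : gen x -> gen y -> gen (x `&` y).
Proof. by move=> hx hy U [sU GU]; have [] := sU _ _ (hx U _) (hy U _). Qed.

Lemma gen_pentagonU x y : gen x -> gen y -> gen (x `|` y).
Proof. by move=> hx hy U [sU GU]; have [] := sU _ _ (hx U _) (hy U _). Qed.

(** The missing lifts come from 0 = gamma /\ beta, delta = gamma \/ beta and beta_1 = beta_0. *)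
Lemma gen_lift i th : th \in [:: \bot; gamma; alpha; beta; delta] ->
  gen (lift i th).
Proof.
have gen_gamma j : gen (lift j gamma).
  by apply: gen_pentagon; rewrite /pentagon_gens; case: j => /=; tauto.
have gen_alpha j : gen (lift j alpha).
  by apply: gen_pentagon; rewrite /pentagon_gens; case: j => /=; tauto.
have gen_beta j : gen (lift j beta).
  rewrite (lift_above_beta j false) //.
  by apply: gen_pentagon; rewrite /pentagon_gens /=; tauto.
rewrite !inE => /or4P[/eqP->|/eqP->//|/eqP->//|/orP[/eqP->//|/eqP->]].
  rewrite -(pentagon_gammaI pentagon) liftI; exact: gen_pentagonI.
rewrite -(pentagon_gammaU pentagon) liftU; exact: gen_pentagonU.
Qed.

Lemma gen_bot : gen \bot.
Proof.
by rewrite -(lift_botI beta false); apply: gen_pentagonI; apply: gen_lift;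
  rewrite mem_head.
Qed.

(** * The embedding of K *)

Definition K_map (x : lattice_K) : congruence (congr_alg beta) :=
  match x with
  | K_0 => \bot
  | K_e0 => lift false \bot
  | K_e1 => lift true \bot
  | K_c0 => lift false gamma
  | K_c1 => lift true gamma
  | K_a0 => lift false alpha
  | K_a1 => lift true alpha
  | K_b => lift false beta
  | K_m => lift false gamma `&` lift true gamma
  | K_p => lift false gamma `&` lift true alpha
  | K_q => lift true gamma `&` lift false alpha
  | K_t => (lift false gamma `&` lift true alpha)
             `|` (lift true gamma `&` lift false alpha)
  | K_s => lift false alpha `&` lift true alpha
  | K_d => lift false delta
  end.

Lemma K_iso : ~ (rcomp (rcomp beta gamma) beta `&` alpha `<=` gamma)%classic ->
  sublattice_iso gen lattice_K.
Proof.
move=> ncond.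
apply: (@sublattice_iso_of_edges _ _ _ _ (grel K_covers) _ _ K_code K_map).
- by [].
- by move=> x y /(hasse_cover K_elems_complete K_ok).
- exact: can_inj K_codeK.
- have le_ad : alpha <= delta := ltW (pentagon_alpha_delta pentagon).
  have le_lift i : lift i gamma <= lift i alpha by rewrite lift_le.
  move=> x y; case: x; case: y => //= _;
    rewrite ?lift_le ?leIl ?leIr ?leUl ?leUr ?le0x //;
    try by apply: lift_le_above_beta; rewrite ?le0x.
  + exact: leI2.
  + by rewrite meetC leI2.
  + by rewrite leUx leI2 //= meetC leI2.
- move=> x y z; case: x; case: y => // _; case: z => // _ _ /=.
  + exact: (lift_beta_join false).
  + by rewrite (lift_bot_join beta false).
  + by rewrite meetC (lift_bot_join beta true).
  + exact: lift_gamma_betaU.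
  + by rewrite !(lift_above_beta false true) // lift_gamma_betaU.
  (* Here c_0 \/ t = a_0, because t contains q and already c_0 \/ q = a_0; the next case is
     symmetric, with p. *)
  + apply: le_trans (leU2 (lexx _) (leUr _ _)).
    by apply: (lift_gamma_alphaI_join (i := true)); rewrite lift_gamma_alphaI_le.
  + apply: le_trans (leU2 (lexx _) (leUl _ _)).
    by apply: (lift_gamma_alphaI_join (i := false)); rewrite lift_gamma_alphaI_le.
  + exact: (lift_delta_le false (pentagon_alphaU pentagon)).
- move=> x y z; case: x; case: y => // _; case: z => // _ _ /=.
  + by rewrite -(lift_bot_alphaI false) leI2 // leIr.
  + by rewrite -(lift_bot_alphaI true) leI2 // leIr.
  + by rewrite leI2 // leIr.
  + by rewrite leI2 // leIl.
  + by rewrite (lift_botI beta false).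
  + by rewrite leI2 // leIl.
  + exact: lift_alpha_betaI.
  + by rewrite (lift_above_beta false true) // lift_alpha_betaI.
(* A second lower cover contradicts [h]; this leaves the join irreducible e_0, e_1, m, p, q and
   s. *)
- move=> x y; case: x; case: y => // _ /= h;
    try by [have := h K_e0 isT | have := h K_e1 isT | have := h K_c0 isT |
            have := h K_c1 isT | have := h K_p isT | have := h K_q isT |
            have := h K_s isT | have := h K_a0 isT | have := h K_a1 isT].
  + by move/esym/lift_bot_neq.
  + by move/esym/lift_bot_neq.
  + by move/esym/(@lift_gammaI_neq false).
  + move=> E; apply: ncond; apply/(lift_gamma_alphaI_le false).
    by rewrite -E leIr.
  + move=> E; apply: ncond; apply/(lift_gamma_alphaI_le true).
    by rewrite -E leIl.
  + exact: lift_gamma_alphaIU_neq.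
- by case; do ?[exact: gen_bot | apply: gen_pentagonI | apply: gen_pentagonU |
                by apply: gen_lift; rewrite !inE eqxx ?orbT].
- by move=> x [[[[->|->]|->]|->]|->];
    [exists K_a0|exists K_a1|exists K_c0|exists K_c1|exists K_b].
Qed.

(** * The embedding of M_1 *)

Definition M1_map (x : lattice_M1) : congruence (congr_alg beta) :=
  match x with
  | M1_0 => \bot
  | M1_e0 => lift false \bot
  | M1_e1 => lift true \bot
  | M1_c0 => lift false gamma
  | M1_c1 => lift true gamma
  | M1_a0 => lift false alpha
  | M1_a1 => lift true alpha
  | M1_b => lift false beta
  | M1_m => lift false gamma `&` lift true gamma
  | M1_s => lift false alpha `&` lift true alpha
  | M1_d => lift false delta
  end.

Lemma M1_iso : (rcomp (rcomp beta gamma) beta `&` alpha `<=` gamma)%classic ->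
  sublattice_iso gen lattice_M1.
Proof.
move=> cond.
have alphaI_le i := (lift_gamma_alphaI_le i).2 cond.
apply: (@sublattice_iso_of_edges _ _ _ _ (grel M1_covers) _ _ M1_code M1_map).
- by [].
- by move=> x y /(hasse_cover M1_elems_complete M1_ok).
- exact: can_inj M1_codeK.
- have le_ad : alpha <= delta := ltW (pentagon_alpha_delta pentagon).
  have le_lift i : lift i gamma <= lift i alpha by rewrite lift_le.
  move=> x y; case: x; case: y => //= _;
    rewrite ?lift_le ?leIl ?leIr ?leUl ?leUr ?le0x ?leI2 //;
    try by apply: lift_le_above_beta; rewrite ?le0x.
- move=> x y z; case: x; case: y => // _; case: z => // _ _ /=.
  + exact: (lift_beta_join false).
  + by rewrite (lift_bot_join beta false).
  + by rewrite meetC (lift_bot_join beta true).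
  + exact: lift_gamma_betaU.
  + by rewrite !(lift_above_beta false true) // lift_gamma_betaU.
  + exact: (lift_delta_le false (pentagon_gammaU pentagon)).
  + exact: (lift_gamma_alphaIU false).
  + by rewrite (meetC (lift false alpha)) (lift_gamma_alphaIU true).
  + exact: (lift_delta_le false (pentagon_alphaU pentagon)).
- move=> x y z; case: x; case: y => // _; case: z => // _ _ /=.
  + rewrite -(lift_bot_alphaI false) leI2 //.
    by apply: le_trans (leIr _ _) _; rewrite lift_le.
  + rewrite -(lift_bot_alphaI true) leI2 //.
    by apply: le_trans (leIl _ _) _; rewrite lift_le.
  (* c_0 /\ s lies below c_0 /\ a_1, which [cond] puts below c_1; hence it is m. *)
  + rewrite lexI leIl /=.
    by apply: le_trans (alphaI_le false); rewrite leI2 // leIr.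
  + rewrite lexI leIl andbT.
    by apply: le_trans (alphaI_le true); rewrite leI2 // leIl.
  + by rewrite (lift_botI beta false).
  + exact: lift_alpha_betaI.
  + by rewrite (lift_above_beta false true) // lift_alpha_betaI.
- move=> x y; case: x; case: y => // _ /= h;
    try by [have := h M1_e0 isT | have := h M1_e1 isT | have := h M1_c0 isT |
            have := h M1_c1 isT | have := h M1_m isT | have := h M1_s isT |
            have := h M1_a0 isT | have := h M1_a1 isT].
  + by move/esym/lift_bot_neq.
  + by move/esym/lift_bot_neq.
  + by move/esym/(@lift_gammaI_neq false).
  + exact: (lift_gammaI_neq_alphaI (i := false)).
- by case; do ?[exact: gen_bot | apply: gen_pentagonI | apply: gen_pentagonU |
                by apply: gen_lift; rewrite !inE eqxx ?orbT].
- by move=> x [[[[->|->]|->]|->]|->];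
    [exists M1_a0|exists M1_a1|exists M1_c0|exists M1_c1|exists M1_b].
Qed.

End Pentagon.

Local Close Scope order_scope.

Theorem theorem1p2 (S : signature) (A : algebra S)
    (alpha beta gamma delta : congruence A)
    (pentagon : labelled_pentagon gamma alpha beta delta)
    (interval_eq :
      [set theta : congruence A | (gamma <= theta <= alpha)%O]
      = [set gamma; alpha]) :
  let L : set (congruence (congr_alg beta)) :=
    gen_sublattice
      [set congr_lift0 beta alpha; congr_lift1 beta alpha; congr_lift0 beta gamma;
           congr_lift1 beta gamma; congr_lift0 beta beta] in
  (sublattice_iso L lattice_K <->
     ~ (rcomp (rcomp beta gamma) beta `&` alpha `<=` gamma)) /\
  (rcomp (rcomp beta gamma) beta `&` alpha `<=` gamma ->
     sublattice_iso L lattice_M1).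
Proof.
split; last by apply: M1_iso pentagon.
split; last by apply: K_iso pentagon interval_eq.
(* If the inclusion held, L would be a copy of both lattices, giving 14 <= 11. *)
move=> isoK /(M1_iso pentagon) isoM1.
have := card_le_of_sublattice_iso isoK isoM1.
by rewrite !cardT !enumT !unlock.
Qed.
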